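(* Let $n\ge 2$ and let $A, B, P_1,\dots,P_n, Q_1,\dots,Q_n, R_1,\dots,R_n, S_1,\dots,S_n$ be points on the real (resp. complex) projective plane, with all indices viewed modulo $n$. Assume the following nondegeneracy conditions for every $i$: $A\ne P_i$ and $B\neq R_i$; the points $Q_i,S_i,S_{i-1}$ are not collinear and the points $S_i,Q_i,Q_{i+1}$ are not collinear; the line $(Q_iS_i)$ contains none of $A,P_i,P_{i+1},R_i$; the line $(Q_{i+1}S_i)$ contains none of $B,R_i,R_{i+1},P_{i+1}$. Consider the following $4n$ conditions ($i=1,\dots,n$): (1) the lines $(Q_iS_i)$, $(Q_{i-1}S_{i-1})$, $(AP_i)$ are concurrent; (2) the lines $(Q_iS_{i-1})$, $(Q_{i+1}S_i)$, $(BR_i)$ are concurrent; (3) the points $P_i$, $Q_i$, $R_i$ are collinear; (4) the points $R_i$, $S_i$, $P_{i+1}$ are collinear. If $4n-1$ of these $4n$ conditions hold, then so does the remaining one.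
   Context: $(XY)$ denotes the line through two distinct points $X,Y$. Lines are concurrent if they have a common point. *)

(* Defs.v *)
From HB Require Import structures.
From mathcomp Require Import all_boot all_order all_algebra.
From mathcomp Require Import reals complex.

Set Implicit Arguments.
Unset Strict Implicit.
Unset Printing Implicit Defensive.

Import GRing.Theory.
Local Open Scope ring_scope.

(* Points and lines of the projective plane P(K^3) are the subspaces of K^3 of
   dimension 1 and 2; a point lies on a line when it is a subspace of it. *)
Definition point (K : fieldType) : Type :=
  {U : {vspace 'rV[K]_3} | \dim U == 1%N}.

Definition line (K : fieldType) : Type :=
  {U : {vspace 'rV[K]_3} | \dim U == 2}.

(* The line (XY), which is only meaningful for X <> Y: see dim_line_through.
   For X = Y this sum is the point X itself, so it is kept as a subspace. *)
Definition line_through (K : fieldType) (X Y : point K) : {vspace 'rV[K]_3} :=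
  (val X + val Y)%VS.

Lemma dim_line_through (K : fieldType) (X Y : point K) :
  X <> Y -> \dim (line_through X Y) == 2.
Proof.
case: X Y => [U dU] [V dV] neqUV; rewrite /line_through /=.
have cap0 : (U :&: V = 0)%VS.
  apply/eqP; rewrite -dimv_eq0; apply/negPn/negP; rewrite -lt0n => cap_gt0.
  have /eqP capU : (U :&: V == U)%VS by rewrite eqEdim capvSl (eqP dU).
  have /eqP capV : (U :&: V == V)%VS by rewrite eqEdim capvSr (eqP dV).
  by apply: neqUV; apply: val_inj; rewrite /= -capU capV.
by rewrite dimv_disjoint_sum // (eqP dU) (eqP dV).
Qed.

Definition on_line (K : fieldType) (X : point K) (l : {vspace 'rV[K]_3}) : Prop :=
  (val X <= l)%VS.

Definition collinear (K : fieldType) (X Y Z : point K) : Prop :=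
  exists l : line K,
    [/\ on_line X (val l), on_line Y (val l) & on_line Z (val l)].

Definition concurrent (K : fieldType) (l1 l2 l3 : {vspace 'rV[K]_3}) : Prop :=
  exists X : point K, [/\ on_line X l1, on_line X l2 & on_line X l3].

Variant condition_kind : Type :=
  QSconcurrentA | QSconcurrentB | PQRcollinear | RSPcollinear.

(* [ordS] and [ord_pred] are the successor and the predecessor modulo n. *)
Definition incidence_condition (K : fieldType) (n : nat) (A B : point K)
    (P Q R S : 'I_n -> point K) (k : condition_kind) (i : 'I_n) : Prop :=
  match k with
  | QSconcurrentA =>
      concurrent (line_through (Q i) (S i))
                 (line_through (Q (ord_pred i)) (S (ord_pred i)))
                 (line_through A (P i))
  | QSconcurrentB =>
      concurrent (line_through (Q i) (S (ord_pred i)))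
                 (line_through (Q (ordS i)) (S i))
                 (line_through B (R i))
  | PQRcollinear => collinear (P i) (Q i) (R i)
  | RSPcollinear => collinear (R i) (S i) (P (ordS i))
  end.

(* Main.v *)
Require Import Defs.
From mathcomp Require Import all_boot all_order all_algebra.
From mathcomp Require Import reals complex ring.

(** Choose a vector in every point and a linear form vanishing on every line,
    and write [<X, l>] for the value of the form of [l] at the vector of [X].
    A quadruple consisting of two points [X], [Y] and two lines [l], [m] obeys

      <X, l> <Y, m> - <X, m> <Y, l> = (x * y) . (l * m)

    where [x * y] is the cross product, the form of the line [XY], and [l * m]
    is a vector in the point common to [l] and [m].  So the equation
    [<X, l> <Y, m> = <X, m> <Y, l>] says that [l], [m] and [XY] are concurrent;
    it does not depend on the choices made, since rescaling a vector or a form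
    multiplies both sides by the same factor.

    With [a_i] the line [Q_i S_i] and [b_i] the line [Q_(i+1) S_i], each of the
    4n conditions is an equation of this kind:
      - (1) has points [A], [P_i] and lines [a_i], [a_(i-1)];
      - (2) has points [B], [R_i] and lines [b_(i-1)], [b_i];
      - (3) has points [P_i], [R_i] and lines [a_i], [b_(i-1)], which meet in
        [Q_i];
      - (4) has points [R_i], [P_(i+1)] and lines [a_i], [b_i], which meet in
        [S_i].
    Lemmas [concurrent_tile] and [collinear_tile] establish this, and
    [incidence_conditionE] records the outcome.

    These quadrilaterals are the tiles of a closed surface, whose vertices are
    the points and the lines and whose edges are the pairs [(X, l)].  Every edge
    belongs to two tiles, and contributes the bracket [<X, l>] to the left side
    of one equation and to the right side of the other.  Hence the product of
    all left sides equals the product of all right sides ([prod_tiles]), and as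
    the nondegeneracy conditions make all brackets nonzero, 4n - 1 of the
    equations imply the last one ([prod_eq_remaining]). *)

Section Coordinates.

Set Implicit Arguments.
Unset Strict Implicit.
Unset Printing Implicit Defensive.

Import GRing.Theory.
Local Open Scope ring_scope.
Variable K : fieldType.
Implicit Types (u v w x y z : 'rV[K]_3) (X Y Z U V W : point K).

(** * Vector algebra in dimension 3 *)

Definition dot x y : K := \sum_(j < 3) x 0 j * y 0 j.

(** The index arithmetic is that of the ring ['I_3], hence modulo 3, so that a
    single formula covers the three coordinates. *)
Definition cross x y : 'rV[K]_3 :=
  \row_j (x 0 (j + 1) * y 0 (j + 2) - x 0 (j + 2) * y 0 (j + 1)).

Lemma sum_ord3 (F : 'I_3 -> K) : \sum_j F j = F 0 + F 1 + F 2.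
Proof.
rewrite !big_ord_recl big_ord0 addr0 addrA.
by congr (_ + F _ + F _); apply: val_inj.
Qed.

Lemma crossE x y :
  (cross x y 0 0 = x 0 1 * y 0 2 - x 0 2 * y 0 1) *
  (cross x y 0 1 = x 0 2 * y 0 0 - x 0 0 * y 0 2) *
  (cross x y 0 2 = x 0 0 * y 0 1 - x 0 1 * y 0 0).
Proof.
rewrite !mxE; do !split; congr (x 0 _ * y 0 _ - x 0 _ * y 0 _);
  exact: val_inj.
Qed.

Lemma ord3_ind (T : 'I_3 -> Prop) : T 0 -> T 1 -> T 2 -> forall j, T j.
Proof.
move=> T0 T1 T2 [[|[|[|//]]] lt_j].
- by rewrite (_ : Ordinal lt_j = 0) //; apply: val_inj.
- by rewrite (_ : Ordinal lt_j = 1) //; apply: val_inj.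
- by rewrite (_ : Ordinal lt_j = 2) //; apply: val_inj.
Qed.

Definition dotE x y : dot x y = x 0 0 * y 0 0 + x 0 1 * y 0 1 + x 0 2 * y 0 2 :=
  sum_ord3 _.

Lemma row_linE :
  (forall a x (j : 'I_3), (a *: x) 0 j = a * x 0 j) *
  (forall x y (j : 'I_3), (x + y) 0 j = x 0 j + y 0 j).
Proof. by split=> *; rewrite mxE. Qed.

Lemma dot_cross_cross x y u v :
  dot (cross x y) (cross u v) = dot x u * dot y v - dot x v * dot y u.
Proof. by rewrite !dotE !crossE; ring. Qed.

Lemma dot_crossC x y z : dot x (cross z y) = - dot x (cross y z).
Proof. by rewrite !dotE !crossE; ring. Qed.

(** Two lines through a point meet in that point: the lines [UV] and [UW], as
    linear forms, have a cross product proportional to [u]. *)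
Lemma cross_pencil u v w : cross (cross u v) (cross u w) = dot u (cross v w) *: u.
Proof.
by apply/rowP; elim/ord3_ind; rewrite crossE row_linE dotE !crossE; ring.
Qed.

Lemma dot_crossCA x y z : dot x (cross y z) = dot y (cross z x).
Proof. by rewrite !dotE !crossE; ring. Qed.

Lemma dotC x y : dot x y = dot y x.
Proof. by rewrite !dotE; ring. Qed.

Lemma dotZr a x y : dot x (a *: y) = a * dot x y.
Proof. by rewrite !dotE !mxE; ring. Qed.

(** Cramer's rule: a vector annihilated by the form [cross x y] becomes an
    explicit combination of [x] and [y] once some coordinate of that form can be
    inverted. *)
Lemma scaler_cross x y u (j : 'I_3) :
  cross x y 0 j *: u
  = cross u y 0 j *: x + cross x u 0 j *: y + dot u (cross x y) *: delta_mx 0 j.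
Proof.
by apply/rowP; elim/ord3_ind: j; elim/ord3_ind;
  rewrite dotE !row_linE !crossE !mxE /=; ring.
Qed.

Lemma cross0P x y : x != 0 -> cross x y = 0 -> exists a, y = a *: x.
Proof.
move=> nz_x xy0.
have [j xj] : exists j, x 0 j != 0 by apply/rV0Pn.
exists (y 0 j / x 0 j); apply: (scalerI xj).
rewrite scalerA mulrCA divff // mulr1.
have [[C0 C1] C2] := crossE x y; rewrite xy0 !mxE in C0 C1 C2.
apply/rowP; elim/ord3_ind; elim/ord3_ind: j {xj}; rewrite !mxE;
  apply/eqP; rewrite -subr_eq0; apply/eqP;
  first [ring | by rewrite C0; ring | by rewrite C1; ring | by rewrite C2; ring
        | by rewrite -oppr0 C0; ring | by rewrite -oppr0 C1; ring
        | by rewrite -oppr0 C2; ring].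
Qed.

(** The triple product is a determinant, whose vanishing amounts to a nontrivial
    kernel.  Applied to three linear forms, the kernel vector is a point common
    to the three lines. *)
Lemma triple0P x y z :
  reflect (exists2 v, v != 0 & [/\ dot v x = 0, dot v y = 0 & dot v z = 0])
          (dot x (cross y z) == 0).
Proof.
pose M : 'M[K]_3 := \matrix_(i, j) (nth 0 [:: x; y; z] j) 0 i.
have MP v j : (v *m M) 0 j = dot v (nth 0 [:: x; y; z] j).
  by rewrite mxE; apply: eq_bigr => k _; rewrite mxE.
have -> : dot x (cross y z) = \det M.
  (* Naming the coordinates by natural numbers lets the column indices of the
     cofactors compute. *)
  pose c w k := w 0 (inord k : 'I_3).
  have cE w (j : 'I_3) : w 0 j = c w j by rewrite /c inord_val.
  rewrite !(expand_det_row _ 0) !big_ord_recl !big_ord0 /cofactor.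
  rewrite !(expand_det_row _ 0) !big_ord_recl !big_ord0 /cofactor !det_mx11 !mxE.
  rewrite dotE !crossE !cE /= !modn_small // /bump /=; ring.
apply: (iffP idP) => [/det0P[v nz_v /rowP vM] | [v nz_v [v1 v2 v3]]].
  exists v => //.
  by split; [have := vM 0 | have := vM 1 | have := vM 2]; rewrite MP mxE.
by apply/det0P; exists v => //; apply/rowP; elim/ord3_ind; rewrite MP mxE.
Qed.

(** * Homogeneous coordinates *)

Definition vec X : 'rV[K]_3 := vpick (val X).

Lemma vec_neq0 X : vec X != 0.
Proof. by rewrite vpick0 -dimv_eq0 (eqP (valP X)). Qed.

Lemma val_vec X : val X = <[vec X]>%VS.
Proof.
apply/esym/eqP; rewrite eqEdim -memvE memv_pick /=.
by rewrite (eqP (valP X)) dim_vline vec_neq0.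
Qed.

Lemma point_of_vec u : u != 0 -> exists X, val X = <[u]>%VS.
Proof.
move=> nz_u; have dim_u : \dim <[u]> == 1%N by rewrite dim_vline nz_u.
by exists (exist _ <[u]>%VS dim_u).
Qed.

Lemma on_lineE X (l : {vspace 'rV[K]_3}) : on_line X l = (vec X \in l).
Proof. by rewrite /on_line val_vec memvE. Qed.

Lemma cross_vec_neq0 X Y : X <> Y -> cross (vec X) (vec Y) != 0.
Proof.
move=> neqXY; apply/negP => /eqP /(cross0P (vec_neq0 X)) [a Ya].
case: neqXY; apply/esym/val_inj/eqP.
rewrite eqEdim (eqP (valP X)) (eqP (valP Y)) leqnn andbT.
by rewrite !val_vec -memvE Ya memvZ ?memv_line.
Qed.

Lemma mem_line_through X Y u : X <> Y ->
  (u \in line_through X Y) = (dot u (cross (vec X) (vec Y)) == 0).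
Proof.
move=> /cross_vec_neq0 nz_c; rewrite /line_through !val_vec.
apply/idP/eqP => [/memv_addP[_ /vlineP[a ->] [_ /vlineP[b ->] ->]] | u0].
  by rewrite dotE !row_linE !crossE; ring.
have [j cj] : exists j, cross (vec X) (vec Y) 0 j != 0 by apply/rV0Pn.
have := scaler_cross (vec X) (vec Y) u j; rewrite u0 scale0r addr0.
move/(canRL (scalerK cj)) => ->.
by rewrite memvZ // memv_add ?memvZ ?memv_line.
Qed.

Lemma exists_neq_point X : exists Y, X <> Y.
Proof.
pose w := vpick (val X)^C.
have nz_w : w != 0.
  by rewrite vpick0 -dimv_eq0 dimv_compl dimvf /dim /= (eqP (valP X)).
have [Y dY] := point_of_vec nz_w; exists Y => XY.
have: w \in (val X :&: (val X)^C)%VS.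
  by rewrite memv_cap memv_pick XY dY memv_line.
by rewrite capv_compl memv0 (negPf nz_w).
Qed.

(** When [Y <> Z] this is the value at [X] of the linear form of the line [YZ];
    it is also the determinant of the three points. *)
Definition bracket X Y Z : K := dot (vec X) (cross (vec Y) (vec Z)).

Lemma bracketCr X Y Z : bracket X Z Y = - bracket X Y Z.
Proof. exact: dot_crossC. Qed.

Lemma bracketCA X Y Z : bracket X Y Z = bracket Y Z X.
Proof. exact: dot_crossCA. Qed.

Lemma bracket_line X Y Z : Y <> Z ->
  on_line X (line_through Y Z) <-> bracket X Y Z = 0.
Proof. by move=> nYZ; rewrite on_lineE mem_line_through //; split=> /eqP. Qed.

Lemma bracketxx X Y : bracket X Y Y = 0.
Proof. by rewrite /bracket dotE !crossE; ring. Qed.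

Lemma on_line_throughl X Y : on_line X (line_through X Y).
Proof. exact: addvSl. Qed.

Lemma on_line_throughr X Y : on_line Y (line_through X Y).
Proof. exact: addvSr. Qed.

Lemma collinear_on_line X Y Z V W : V <> W ->
  on_line X (line_through V W) -> on_line Y (line_through V W) ->
  on_line Z (line_through V W) -> collinear X Y Z.
Proof.
move=> nVW onX onY onZ.
by exists (exist _ (line_through V W) (dim_line_through nVW)).
Qed.

(** Two distinct points among the three span the common line; when all three
    coincide, the line joining them to an auxiliary point will do. *)
Lemma collinear_bracket X Y Z : collinear X Y Z <-> bracket X Y Z = 0.
Proof.
split=> [[l [Xl Yl Zl]] | b0].
  have [->|/eqP nYZ] := eqVneq Y Z; first exact: bracketxx.
  apply/bracket_line => //; congr (on_line X _): Xl; apply/esym/eqP.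
  by rewrite eqEdim subv_add Yl Zl (eqP (valP l)) (eqP (dim_line_through nYZ)).
have [YZ|/eqP nYZ] := eqVneq Y Z; last first.
  apply: (collinear_on_line nYZ); first exact/bracket_line.
    exact: on_line_throughl.
  exact: on_line_throughr.
have [W [nXW YW]] : exists W, X <> W /\ (Y = X \/ Y = W).
  have [<-|/eqP nXY] := eqVneq X Y; last by exists Y; split=> //; right.
  by have [W nXW] := exists_neq_point X; exists W; split=> //; left.
have Yl : on_line Y (line_through X W).
  by case: YW => ->; [exact: on_line_throughl | exact: on_line_throughr].
by apply: (collinear_on_line nXW) => //; [exact: on_line_throughl | rewrite -YZ].
Qed.

Lemma concurrent_dot X X' Y Y' Z Z' : X <> X' -> Y <> Y' -> Z <> Z' ->
  concurrent (line_through X X') (line_through Y Y') (line_through Z Z') <->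
  dot (cross (vec Z) (vec Z'))
      (cross (cross (vec X) (vec X')) (cross (vec Y) (vec Y'))) = 0.
Proof.
move=> nX nY nZ; split=> [[U [UX UY UZ]] | /eqP/triple0P[u nz_u [uZ uX uY]]].
  apply/eqP/triple0P; exists (vec U); first exact: vec_neq0.
  by split; apply/eqP; rewrite -mem_line_through // -on_lineE.
have [U dU] := point_of_vec nz_u; exists U.
by split; rewrite /on_line dU -memvE mem_line_through // (uX, uY, uZ).
Qed.

(** * Tiles *)

(** By [dot_cross_cross] the difference of the two sides is the triple product of
    the forms of the three lines.  When the first two lines coincide, both the
    concurrency and the equation hold. *)
Lemma concurrent_tile X Y U V U' V' : U <> V -> U' <> V' -> X <> Y ->
  concurrent (line_through U V) (line_through U' V') (line_through X Y) <->
  bracket X U V * bracket Y U' V' = bracket X U' V' * bracket Y U V.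
Proof.
move=> nUV nUV' nXY; rewrite concurrent_dot // dot_cross_cross.
by split=> /eqP; [rewrite subr_eq0 => /eqP | rewrite -subr_eq0 => /eqP].
Qed.

(** The lines [UV] and [UW] meet in [U], so by [cross_pencil] the difference of
    the two sides is, up to sign, [bracket X U Y] times the nonzero
    [bracket U V W]. *)
Lemma collinear_tile X Y U V W : ~ collinear U V W ->
  collinear X U Y <->
  bracket X U V * bracket Y U W = bracket X U W * bracket Y U V.
Proof.
rewrite !collinear_bracket => /eqP nz_UVW.
have tileE : bracket X U V * bracket Y U W - bracket X U W * bracket Y U V
             = - (bracket U V W * bracket X U Y).
  rewrite -dot_cross_cross cross_pencil dotZr (dotC (cross _ _)).
  rewrite -!/(bracket _ _ _) [bracket U X Y]bracketCA.
  by rewrite [bracket X Y U]bracketCr mulrN.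
split=> [XUY | /eqP]; first by apply/eqP; rewrite -subr_eq0 tileE XUY mulr0 oppr0.
by rewrite -subr_eq0 tileE oppr_eq0 mulf_eq0 (negPf nz_UVW) => /eqP.
Qed.

Lemma bracket_neq0 X Y Z : Y <> Z -> ~ on_line X (line_through Y Z) ->
  bracket X Y Z != 0.
Proof. by move=> nYZ offX; apply/eqP; rewrite -bracket_line. Qed.

Lemma neq_of_noncollinear X Y Z : ~ collinear X Y Z -> X <> Y.
Proof.
move=> ncXYZ XY; apply: ncXYZ; rewrite collinear_bracket -XY.
by rewrite bracketCA bracketCA bracketxx.
Qed.

(** * The closed surface *)

Lemma prod_eq_remaining (J : finType) (f g : J -> K) (j0 : J) :
  (forall j, g j != 0) -> \prod_j f j = \prod_j g j ->
  (forall j, j != j0 -> f j = g j) -> f j0 = g j0.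
Proof.
move=> nz_g; rewrite (bigD1 j0) //= [RHS](bigD1 j0) //= => eq_fg fg.
have nz_r : \prod_(j | j != j0) g j != 0 by apply/prodf_neq0 => j _; apply: nz_g.
by apply: (mulIf nz_r); rewrite -eq_fg; congr (_ * _); apply: eq_bigr => j /fg.
Qed.

Section Configuration.

Variables (n : nat) (A B : point K) (P Q R S : 'I_n -> point K).

Definition bracketQS X i := bracket X (Q i) (S i).
Definition bracketQnextS X i := bracket X (Q (ordS i)) (S i).

(** In each tile the sides are oriented so that neighbouring tiles carry their
    common bracket on opposite sides. *)
Definition tile_lhs (k : condition_kind) (i : 'I_n) : K :=
  match k with
  | QSconcurrentA => bracketQS A i * bracketQS (P i) (ord_pred i)
  | QSconcurrentB => bracketQnextS B (ord_pred i) * bracketQnextS (R i) i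
  | PQRcollinear => bracketQS (P i) i * bracketQnextS (R i) (ord_pred i)
  | RSPcollinear => bracketQS (R i) i * bracketQnextS (P (ordS i)) i
  end.

Definition tile_rhs (k : condition_kind) (i : 'I_n) : K :=
  match k with
  | QSconcurrentA => bracketQS A (ord_pred i) * bracketQS (P i) i
  | QSconcurrentB => bracketQnextS B i * bracketQnextS (R i) (ord_pred i)
  | PQRcollinear => bracketQnextS (P i) (ord_pred i) * bracketQS (R i) i
  | RSPcollinear => bracketQnextS (R i) i * bracketQS (P (ordS i)) i
  end.

(** An indexing of the four kinds by a finite type, for products over all
    conditions. *)
Definition kind_of_bools (c d : bool) : condition_kind :=
  if c then if d then QSconcurrentA else QSconcurrentB
  else if d then PQRcollinear else RSPcollinear.

(** Each bracket occurs once on either side; those of [A], [B] and [P] occur with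
    indices shifted by one, which the cyclic reindexing absorbs. *)
Lemma prod_tiles :
  \prod_(j : (bool * bool) * 'I_n) tile_lhs (kind_of_bools j.1.1 j.1.2) j.2
  = \prod_(j : (bool * bool) * 'I_n) tile_rhs (kind_of_bools j.1.1 j.1.2) j.2.
Proof.
have shift (F : 'I_n -> 'I_n -> K) :
    \prod_i F (ordS i) i = \prod_i F i (ord_pred i).
  rewrite [RHS](reindex_inj (@ordS_inj n)).
  by apply: eq_bigr => i _; rewrite ordSK.
have expand (F : condition_kind -> 'I_n -> K) :
    \prod_(j : (bool * bool) * 'I_n) F (kind_of_bools j.1.1 j.1.2) j.2
    = (\prod_i F QSconcurrentA i * \prod_i F QSconcurrentB i)
      * (\prod_i F PQRcollinear i * \prod_i F RSPcollinear i).
  rewrite -(pair_bigA _ (fun c i => F (kind_of_bools c.1 c.2) i)) /=.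
  rewrite -(pair_bigA _ (fun b b' => \prod_i F (kind_of_bools b b') i)) /=.
  by rewrite !big_bool.
rewrite !expand !big_split /=.
rewrite (shift (fun i j => bracketQS (P i) j)) (shift (fun i j => bracketQnextS (P i) j)).
rewrite -(shift (fun _ j => bracketQS A j)) -(shift (fun _ j => bracketQnextS B j)); ring.
Qed.

Hypothesis hAP : forall i, A <> P i.
Hypothesis hBR : forall i, B <> R i.
Hypothesis hQSS : forall i, ~ collinear (Q i) (S i) (S (ord_pred i)).
Hypothesis hSQQ : forall i, ~ collinear (S i) (Q i) (Q (ordS i)).
Hypothesis hQS : forall i, let l := line_through (Q i) (S i) in
  [/\ ~ on_line A l, ~ on_line (P i) l, ~ on_line (P (ordS i)) l
    & ~ on_line (R i) l].
Hypothesis hQ'S : forall i, let m := line_through (Q (ordS i)) (S i) in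
  [/\ ~ on_line B m, ~ on_line (R i) m, ~ on_line (R (ordS i)) m
    & ~ on_line (P (ordS i)) m].

Lemma neq_QS i : Q i <> S i.
Proof. exact: neq_of_noncollinear (@hQSS i). Qed.

Lemma neq_QnextS i : Q (ordS i) <> S i.
Proof.
move=> QS; apply: (@hSQQ i); rewrite collinear_bracket.
by rewrite QS bracketCA bracketxx.
Qed.

Lemma tile_rhs_neq0 k i : tile_rhs k i != 0.
Proof.
have nzA X j : ~ on_line X (line_through (Q j) (S j)) -> bracketQS X j != 0.
  exact: bracket_neq0 (@neq_QS j).
have nzB X j : ~ on_line X (line_through (Q (ordS j)) (S j)) -> bracketQnextS X j != 0.
  exact: bracket_neq0 (@neq_QnextS j).
have [_ PA PA' RA] := hQS i; have [BB RB _ PB'] := hQ'S i.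
have [AA' _ _ _] := hQS (ord_pred i).
have [_ _ RB' PB] := hQ'S (ord_pred i).
rewrite !ord_predK in RB' PB.
by case: k; rewrite /= mulf_neq0 ?nzA ?nzB // ord_predK.
Qed.

Lemma incidence_conditionE k i :
  incidence_condition A B P Q R S k i <-> tile_lhs k i = tile_rhs k i.
Proof.
have nQS := neq_QS; have nQS' := neq_QnextS.
have predB X : bracketQnextS X (ord_pred i) = bracket X (Q i) (S (ord_pred i)).
  by rewrite /bracketQnextS ord_predK.
have nQSpred : Q i <> S (ord_pred i).
  by have := nQS' (ord_pred i); rewrite ord_predK.
case: k; rewrite /= ?predB.
- exact: concurrent_tile.
- exact: concurrent_tile.
- exact: collinear_tile.
(* Here the two lines are seen as lines through [S i], which reverses the sign
   of all four brackets. *)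
- by rewrite collinear_tile // ![bracket _ (S i) _]bracketCr !mulrNN.
Qed.

End Configuration.

End Coordinates.

Theorem theorem3p12 (RR : realType) (K : fieldType)
  (hK : K = (RR : fieldType) \/ K = (complex RR : fieldType))
  (n : nat) (hn : (2 <= n)%N)
  (A B : point K) (P Q R S : 'I_n -> point K)
  (hAP : forall i, A <> P i)
  (hBR : forall i, B <> R i)
  (hQSS : forall i, ~ collinear (Q i) (S i) (S (ord_pred i)))
  (hSQQ : forall i, ~ collinear (S i) (Q i) (Q (ordS i)))
  (hQS : forall i,
    let l := line_through (Q i) (S i) in
    [/\ ~ on_line A l, ~ on_line (P i) l, ~ on_line (P (ordS i)) l
      & ~ on_line (R i) l])
  (hQ'S : forall i,
    let m := line_through (Q (ordS i)) (S i) in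
    [/\ ~ on_line B m, ~ on_line (R i) m, ~ on_line (R (ordS i)) m
      & ~ on_line (P (ordS i)) m])
  (k0 : condition_kind) (i0 : 'I_n) :
  (forall (k : condition_kind) (i : 'I_n), (k, i) <> (k0, i0) ->
     incidence_condition A B P Q R S k i) ->
  incidence_condition A B P Q R S k0 i0.
Proof.
move=> all_others; apply/incidence_conditionE => //.
have kind_surj k : exists c d, k = kind_of_bools c d.
  by case: k; [exists true, true | exists true, false
              | exists false, true | exists false, false].
have kind_inj c d c' d' :
    kind_of_bools c d = kind_of_bools c' d' -> (c, d) = (c', d').
  by case: c c' d d' => [] [] [] [].
have [c [d def_k0]] := kind_surj k0.
pose lhs (j : bool * bool * 'I_n) :=
  tile_lhs A B P Q R S (kind_of_bools j.1.1 j.1.2) j.2.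
pose rhs (j : bool * bool * 'I_n) :=
  tile_rhs A B P Q R S (kind_of_bools j.1.1 j.1.2) j.2.
have := @prod_eq_remaining K _ lhs rhs (c, d, i0).
rewrite /lhs /rhs /= -def_k0; apply; first by move=> j; apply: tile_rhs_neq0.
  exact: prod_tiles.
move=> [[c' d'] i] /= /eqP neq_j; apply/incidence_conditionE => //.
apply: all_others => -[eq_k eq_i]; apply: neq_j.
by rewrite def_k0 in eq_k; rewrite (kind_inj _ _ _ _ eq_k) eq_i.
Qed.
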